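(* Assume the reduced operator $\widehat A_h\in\mathbb{R}^{n_h\times n_h}$ is square and invertible. Then $$U_\theta-U_h^\star=Z_h\widehat A_h^{-1}r_h .$$
   Context: Let $U_{0,h}\in\mathbb{R}^{N_h}$ and let $Z_h\in\mathbb{R}^{N_h\times n_h}$ have full column rank; the admissible set is $\mathcal U_h=U_{0,h}+Z_h\mathbb{R}^{n_h}$. Let $A_h\in\mathbb{R}^{M_h\times N_h}$, $b_h\in\mathbb{R}^{M_h}$, and set $\widehat A_h:=A_hZ_h$, $\widehat b_h:=b_h-A_hU_{0,h}$. In the square setting $M_h=n_h$. The discrete target is $y_h^\star:=\widehat A_h^{-1}\widehat b_h$, $U_h^\star:=U_{0,h}+Z_hy_h^\star$. The vector $U_\theta=U_{0,h}+Z_hy_\theta$ (with $y_\theta\in\mathbb{R}^{n_h}$) is an arbitrary admissible vector, and its residual is $r_h:=A_hU_\theta-b_h=\widehat A_hy_\theta-\widehat b_h$. *)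

(* Defs.v *)
From mathcomp Require Import all_boot all_order all_algebra.
From mathcomp Require Import reals.

Set Implicit Arguments.
Unset Strict Implicit.
Unset Printing Implicit Defensive.

Import GRing.Theory.
Local Open Scope ring_scope.

Section AffineDiscretization.
Variables (R : realType) (N n M : nat).

Definition full_column_rank (Z : 'M[R]_(N, n)) : Prop := \rank Z = n.

Definition admissible (U0 : 'cV[R]_N) (Z : 'M[R]_(N, n)) (U : 'cV[R]_N) :
    Prop :=
  exists y : 'cV[R]_n, U = U0 + Z *m y.

Definition reduced_operator (Z : 'M[R]_(N, n)) (A : 'M[R]_(M, N)) :
    'M[R]_(M, n) :=
  A *m Z.

Definition reduced_rhs (U0 : 'cV[R]_N) (A : 'M[R]_(M, N)) (b : 'cV[R]_M) :
    'cV[R]_M :=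
  b - A *m U0.

Definition residual (A : 'M[R]_(M, N)) (b : 'cV[R]_M) (U : 'cV[R]_N) :
    'cV[R]_M :=
  A *m U - b.

End AffineDiscretization.

(* Square setting: A has n rows, so that reduced_operator Z A : 'M_n. Since
   invmx is the identity outside unitmx, these two definitions are meaningful
   only when reduced_operator Z A \in unitmx. *)
Section SquareTarget.
Variables (R : realType) (N n : nat).

Definition target_coef (U0 : 'cV[R]_N) (Z : 'M[R]_(N, n)) (A : 'M[R]_(n, N))
    (b : 'cV[R]_n) : 'cV[R]_n :=
  invmx (reduced_operator Z A) *m reduced_rhs U0 A b.

Definition target (U0 : 'cV[R]_N) (Z : 'M[R]_(N, n)) (A : 'M[R]_(n, N))
    (b : 'cV[R]_n) : 'cV[R]_N :=
  U0 + Z *m target_coef U0 Z A b.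

End SquareTarget.

(* Main.v *)
Require Import Defs.
From mathcomp Require Import all_boot all_order all_algebra.
From mathcomp Require Import reals.

Set Implicit Arguments.
Unset Strict Implicit.
Unset Printing Implicit Defensive.

Import GRing.Theory.
Local Open Scope ring_scope.

(** In the coordinate [y] of [Utheta] the residual is affine with linear part the reduced operator,
    so the inverse of that operator sends it to [y] minus the target coefficient; [Z] maps this back
    to the error. *)

Theorem proposition4p2 (R : realType) (N n : nat)
    (U0 : 'cV[R]_N) (Z : 'M[R]_(N, n)) (A : 'M[R]_(n, N)) (b : 'cV[R]_n)
    (hZ : full_column_rank Z)
    (hA : reduced_operator Z A \in unitmx)
    (Utheta : 'cV[R]_N) (hU : admissible U0 Z Utheta) :
  Utheta - target U0 Z A b =
    Z *m invmx (reduced_operator Z A) *m residual A b Utheta.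
Proof.
case: hU => y ->.
have -> : residual A b (U0 + Z *m y) =
    reduced_operator Z A *m y - reduced_rhs U0 A b.
  by rewrite /residual /reduced_rhs mulmxDr mulmxA opprB addrA [in RHS](addrC (_ *m y)).
(* Invertibility enters through [mulKmx]. On the left the two offsets [U0] cancel; [target_coef]
   then unfolds by conversion. *)
by rewrite -mulmxA mulmxBr mulKmx // mulmxBr /target opprD addrACA subrr add0r.
Qed.
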